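(* Let $k\ge2$, $n,r\ge1$, and consider a $k$-valued network $X_i(t+1)=f_i(X_1(t),\dots,X_n(t))$, $i\in[1,n]$, with algebraic form $x(t+1)=Mx(t)$, $M\in\mathcal{L}_{k^n\times k^n}$. Let $\mathcal{Z}=\mathcal{F}_\ell(Z_1,\dots,Z_r)$ be a dual subspace with structure matrix $G\in\mathcal{L}_{k^r\times k^n}$, and define $$S_i:=\{\,j\in[1,k^n]\mid \mathrm{Col}_j(G)=\delta_{k^r}^i\,\},\qquad i\in[1,k^r].$$ Then $\mathcal{Z}$ is $M$-invariant if and only if, for every $i\in[1,k^r]$, the column $\mathrm{Col}_j(GM)$ is constant as $j$ ranges over $S_i$ (a condition which is automatically true if $S_i=\emptyset$).
   Context: Notation. $[1,n]=\{1,\dots,n\}$; $\mathcal{D}_k=\{1,\dots,k\}$; $\delta_n^i$ is the $i$-th column of $I_n$; $\Delta_n=\{\delta_n^1,\dots,\delta_n^n\}$; $\mathrm{Col}_j(A)$ is the $j$-th column of $A$; $\mathcal{L}_{p\times q}$ is the set of $p\times q$ logical matrices (all columns in $\Delta_p$). Network. $X_i\in\mathcal{D}_k$ and $f_i:\mathcal{D}_k^n\to\mathcal{D}_k$ are arbitrary functions. A value $j\in\mathcal{D}_k$ is identified with $\delta_k^j$; $x_i\in\Delta_k$ is the vector form of $X_i$ and $x=x_1\otimes\cdots\otimes x_n\in\Delta_{k^n}$. $M$ is the unique logical matrix with $x(t+1)=Mx(t)$. Dual subspaces. For $k$-valued logical functions $Z_i=g_i(X_1,\dots,X_n)$, $i\in[1,r]$,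 $\mathcal{Z}=\mathcal{F}_\ell(Z_1,\dots,Z_r)$ is the set of all $k$-valued logical functions of $Z_1,\dots,Z_r$. Its structure matrix is the unique $G\in\mathcal{L}_{k^r\times k^n}$ with $z:=z_1\otimes\cdots\otimes z_r=Gx$, where $z_i\in\Delta_k$ is the vector form of $Z_i$. $M$-invariance. $\mathcal{Z}$ is $M$-invariant (an invariant dual subspace of the network) if there is $H\in\mathcal{L}_{k^r\times k^r}$ with $GM=HG$; equivalently $z(t)=Gx(t)$ obeys $z(t+1)=Hz(t)$ along all trajectories. *)

(* Defs.v *)
From mathcomp Require Import all_boot all_order all_algebra.
From mathcomp.real_closed Require Import mxtens.

Set Implicit Arguments.
Unset Strict Implicit.
Unset Printing Implicit Defensive.

Import GRing.Theory.
Local Open Scope ring_scope.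

(* The k values are the elements of 'I_k and every index range [1, m] is 'I_m,
   i.e., everything is numbered from 0 instead of 1. *)
Notation state k n := {ffun 'I_n -> 'I_k}.

Definition logical_function (k n : nat) : Type := state k n -> 'I_k.

Definition joint (k n r : nat) (Z : 'I_r -> logical_function k n)
  (X : state k n) : state k r := [ffun i => Z i X].

Section Algebraic.
(* Logical matrices have only 0/1 entries; real matrices are the instance where
   R is the field of real numbers. *)
Variable R : nzRingType.

Definition delta (n : nat) (i : 'I_n) : 'cV[R]_n := col i 1%:M.

Definition logical_mx (p q : nat) (A : 'M[R]_(p, q)) : Prop :=
  forall j : 'I_q, exists i : 'I_p, col j A = delta i.

(* x_1 *t (x_2 *t (... *t x_n)); the cast turns k * k ^ n into k ^ n.+1. *)
Fixpoint tens_col (k n : nat) : ('I_n -> 'cV[R]_k) -> 'cV[R]_(k ^ n) :=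
  match n return ('I_n -> 'cV[R]_k) -> 'cV[R]_(k ^ n) with
  | 0 => fun _ => const_mx 1
  | n'.+1 => fun x =>
      castmx (esym (expnS k n'), erefl 1%N)
        (x ord0 *t tens_col (fun i => x (lift ord0 i)))
  end.

Definition vec (k n : nat) (X : state k n) : 'cV[R]_(k ^ n) :=
  tens_col (fun i => delta (X i)).

(* For the update functions f of a network (r = n) this characterizes the
   matrix M of x(t+1) = M x(t); for generators Z of a dual subspace it
   characterizes the matrix G of z = G x.  Existence and uniqueness are
   lemma structure_mx_exists_unique. *)
Definition structure_mx (k n r : nat) (Z : 'I_r -> logical_function k n)
  (G : 'M[R]_(k ^ r, k ^ n)) : Prop :=
  logical_mx G /\ forall X : state k n, vec (joint Z X) = G *m vec X.

Definition dual_subspace (k n r : nat) (Z : 'I_r -> logical_function k n)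
  (g : logical_function k n) : Prop :=
  exists h : logical_function k r, forall X, g X = h (joint Z X).

(* The dual subspace is given by its generators Z, since its structure matrix
   is; lemma M_invariant_dual_subspace shows that the property depends only on
   the set dual_subspace Z. *)
Definition M_invariant (k n r : nat) (M : 'M[R]_(k ^ n))
  (Z : 'I_r -> logical_function k n) : Prop :=
  exists G : 'M[R]_(k ^ r, k ^ n), structure_mx Z G /\
    exists H : 'M[R]_(k ^ r), logical_mx H /\ G *m M = H *m G.

Lemma deltaE n (i j : 'I_n) : delta i j 0 = (j == i)%:R.
Proof. by rewrite !mxE. Qed.

Lemma delta_inj n : injective (@delta n).
Proof.
move=> i j /matrixP/(_ i 0); rewrite !deltaE eqxx.
by case: eqP => // _ /eqP; rewrite oner_eq0.
Qed.

Lemma mulmx_delta p q (A : 'M[R]_(p, q)) j : A *m delta j = col j A.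
Proof. by rewrite /delta !colE mul1mx. Qed.

Lemma eq_tens_col k n (x y : 'I_n -> 'cV[R]_k) :
  x =1 y -> tens_col x = tens_col y.
Proof.
elim: n x y => //= n IH x y xy; rewrite xy.
by rewrite (IH _ (fun i => y (lift ord0 i))).
Qed.

Lemma vec_index k n : exists2 e : state k n -> 'I_(k ^ n), bijective e &
  forall X, vec X = delta (e X).
Proof.
suff [e ei eE] : exists2 e : state k n -> 'I_(k ^ n), injective e &
    forall X, vec X = delta (e X).
  by exists e => //; apply: inj_card_bij => //; rewrite card_ffun !card_ord.
elim: n => [|n [e ei eE]].
  exists (fun _ => ord0) => [X Y _|X]; first by apply/ffunP => -[].
  by apply/matrixP => i j; rewrite !mxE !ord1.
pose tl (X : state k n.+1) : state k n := [ffun i => X (lift ord0 i)].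
exists (fun X => cast_ord (esym (expnS k n)) (mxtens_index ((X : state k n.+1) ord0, e (tl X)))).
  move=> X Y /cast_ord_inj/(can_inj (@mxtens_indexK _ _)) [E0 /ei E].
  apply/ffunP => i; case: (unliftP ord0 i) => [j ->|-> //].
  by move/ffunP/(_ j): E; rewrite !ffunE.
move=> X; rewrite /vec /=; set y := tens_col _.
have -> : y = delta (e (tl X)).
  by rewrite -eE; apply: eq_tens_col => i; rewrite ffunE.
apply/matrixP => i j; rewrite castmxE !mxE /= -natrM mulnb; congr (_%:R).
congr nat_of_bool; set u := cast_ord _ i.
rewrite -(inj_eq (@cast_ord_inj _ _ (expnS k n))) cast_ordKV.
have -> : cast_ord (expnS k n) i = mxtens_index (mxtens_unindex u).
  by rewrite mxtens_unindexK; apply: val_inj.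
by rewrite (inj_eq (can_inj (@mxtens_indexK _ _))).
Qed.

Lemma vec_inj k n : injective (@vec k n).
Proof.
have [e eb eE] := vec_index k n.
by move=> X Y; rewrite !eE => /delta_inj; apply: bij_inj.
Qed.

Lemma vec_surj k n (j : 'I_(k ^ n)) : exists X : state k n, vec X = delta j.
Proof.
by have [e [d _ ed] eE] := vec_index k n; exists (d j); rewrite eE ed.
Qed.

Lemma eq_mx_vec k n p (A B : 'M[R]_(p, k ^ n)) :
  (forall X : state k n, A *m vec X = B *m vec X) -> A = B.
Proof.
move=> AB; apply/matrixP => i j; have [X Xj] := vec_surj j.
by move/matrixP/(_ i 0): (AB X); rewrite Xj !mulmx_delta !mxE.
Qed.

Lemma structure_mx_exists_unique k n r (Z : 'I_r -> logical_function k n) :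
  exists! G : 'M[R]_(k ^ r, k ^ n), structure_mx Z G.
Proof.
have [e [d ed de] eE] := vec_index k n; have [e' _ e'E] := vec_index k r.
pose G := \matrix_(i, j) delta (e' (joint Z (d j))) i 0.
have cG j : col j G = delta (e' (joint Z (d j))).
  by apply/matrixP => i l; rewrite !mxE.
have sG : structure_mx Z G.
  by split=> [j|X]; [exists (e' (joint Z (d j))) | rewrite eE mulmx_delta cG ed].
by exists G; split=> // G' [_ G'E]; apply: eq_mx_vec => X; rewrite -G'E -sG.2.
Qed.

Lemma M_invariantP k n r (f : 'I_n -> logical_function k n) M
    (Z : 'I_r -> logical_function k n) : structure_mx f M ->
  M_invariant M Z <->
  exists h : state k r -> state k r,
    forall X, joint Z (joint f X) = h (joint Z X).
Proof.
move=> [_ Mf]; have [e eb eE] := vec_index k r.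
have [d ed de] := eb; split.
  move=> [G [[_ GE] [H [Hl GMH]]]].
  have /fin_all_exists [h hP] Y : exists Y', H *m vec Y = vec Y'.
    have [i iP] := Hl (e Y); exists (d i).
    by rewrite !eE mulmx_delta iP de.
  exists h => X; apply: vec_inj.
  by rewrite -hP !GE Mf !mulmxA GMH.
move=> [h hP]; have [G [sG _]] := structure_mx_exists_unique Z.
have [H [[Hl HE] _]] :=
  structure_mx_exists_unique (fun i (Y : state k r) => h Y i).
exists G; split=> //; exists H; split=> //; apply: eq_mx_vec => X.
rewrite -!mulmxA -Mf -!sG.2 -HE hP; congr vec.
by apply/ffunP => i; rewrite ffunE.
Qed.

Lemma M_invariant_dual_subspace k n r (f : 'I_n -> logical_function k n) M
    (Z Z' : 'I_r -> logical_function k n) : structure_mx f M ->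
    (forall g, dual_subspace Z g <-> dual_subspace Z' g) ->
  M_invariant M Z <-> M_invariant M Z'.
Proof.
move=> Mf; suff sub (Y Y' : 'I_r -> logical_function k n) :
    (forall g, dual_subspace Y g <-> dual_subspace Y' g) ->
    M_invariant M Y -> M_invariant M Y'.
  by move=> ZZ'; split; apply: sub => // g; apply: iff_sym.
move=> YY' /(M_invariantP _ Mf) [h hP]; apply/(M_invariantP _ Mf).
have gen (W W' : 'I_r -> logical_function k n) :
    (forall g, dual_subspace W g -> dual_subspace W' g) ->
    exists u : state k r -> state k r, forall X, joint W X = u (joint W' X).
  move=> WW'; have /fin_all_exists [v vP] i :
      exists v : {ffun state k r -> 'I_k}, forall X, W i X = v (joint W' X).
    have [|v vP] := WW' (W i); last first.
      by exists [ffun s => v s] => X; rewrite vP ffunE.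
    by exists (fun s : state k r => s i) => X; rewrite ffunE.
  by exists (fun s => [ffun i => v i s]) => X; apply/ffunP => i; rewrite !ffunE.
have [u uP] := gen Y Y' (fun g => (YY' g).1).
have [w wP] := gen Y' Y (fun g => (YY' g).2).
by exists (w \o h \o u) => X; rewrite wP hP uP.
Qed.

End Algebraic.

(* Main.v *)
Require Import Defs.
From mathcomp Require Import all_boot all_order all_algebra.
Set Implicit Arguments.
Unset Strict Implicit.
Unset Printing Implicit Defensive.
Local Open Scope ring_scope.

(** If [col j G] is [delta R i], then column [j] of [H *m G] is column [i] of [H]. So
    [G *m M = H *m G] forces the columns of [G *m M] to agree on each [S i]. Conversely, their
    common value on [S i] can serve as column [i] of [H]; [logical_mx_factor] builds this [H] for
    any two logical matrices, and [logical_mulmx] makes it applicable to [G *m M]. *)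

Lemma col_mulmx (R : nzRingType) p q s (A : 'M[R]_(p, q)) (B : 'M[R]_(q, s)) j :
  col j (A *m B) = A *m col j B.
Proof. by rewrite !colE mulmxA. Qed.

Lemma eq_col (R : nzRingType) p q (A B : 'M[R]_(p, q)) :
  (forall j, col j A = col j B) -> A = B.
Proof.
by move=> AB; apply/matrixP => i j; move/matrixP/(_ i 0): (AB j); rewrite !mxE.
Qed.

Lemma logical_mulmx (R : nzRingType) p q s (A : 'M[R]_(p, q))
    (B : 'M[R]_(q, s)) :
  logical_mx A -> logical_mx B -> logical_mx (A *m B).
Proof.
move=> lA lB j; have [l lP] := lB j; have [i iP] := lA l.
by exists i; rewrite col_mulmx lP mulmx_delta.
Qed.

(** Lets the matrix hidden in the existential of [M_invariant] be identified with the given [G]. *)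
Lemma structure_mx_unique (R : nzRingType) k n r
    (Z : 'I_r -> logical_function k n) (G G' : 'M[R]_(k ^ r, k ^ n)) :
  structure_mx Z G -> structure_mx Z G' -> G = G'.
Proof. by move=> [_ GE] [_ G'E]; apply: eq_mx_vec => X; rewrite -GE -G'E. Qed.

(* Columns of H outside the image of B are arbitrary; equal heights of A and B
   supply a default value even when q = 0. *)
Lemma logical_mx_factor (R : nzRingType) p q (A B : 'M[R]_(p, q)) :
    logical_mx A -> logical_mx B ->
    (forall j1 j2, col j1 B = col j2 B -> col j1 A = col j2 A) ->
  exists H : 'M[R]_p, logical_mx H /\ A = H *m B.
Proof.
move=> /fin_all_exists [a aP] /fin_all_exists [b bP] BA.
pose h i := if [pick j | b j == i] is Some j then a j else i.
pose H : 'M[R]_p := \matrix_(l, i) delta R (h i) l 0.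
have colH i : col i H = delta R (h i).
  by apply/matrixP => l m; rewrite !mxE.
exists H; split=> [i|]; first by exists (h i).
apply: eq_col => j; rewrite col_mulmx bP mulmx_delta colH /h.
case: pickP => [j' /eqP bj'|/(_ j)]; last by rewrite eqxx.
(* The picked [j'] need not be [j], but both index the same column of [B], so [BA] makes the choice
   harmless. *)
by rewrite -aP; apply: BA; rewrite !bP bj'.
Qed.

Theorem corollary5 (R : nzRingType) (k n r : nat)
  (hk : (2 <= k)%N) (hn : (1 <= n)%N) (hr : (1 <= r)%N)
  (f : 'I_n -> logical_function k n)
  (M : 'M[R]_(k ^ n)) (hM : structure_mx f M)
  (Z : 'I_r -> logical_function k n)
  (G : 'M[R]_(k ^ r, k ^ n)) (hG : structure_mx Z G) :
  let S (i : 'I_(k ^ r)) : {set 'I_(k ^ n)} :=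
    [set j | col j G == delta R i] in
  M_invariant M Z <->
  forall i : 'I_(k ^ r),
    {in S i &, forall j1 j2, col j1 (G *m M) = col j2 (G *m M)}.
Proof.
move=> S; split=> [[G' [hG' [H [_ GMH]]]] i j1 j2|constS].
  rewrite (structure_mx_unique hG hG') in S * => /[!inE] /eqP j1i /eqP j2i.
  by rewrite GMH !col_mulmx j1i j2i.
exists G; split=> //; apply: logical_mx_factor; [|exact: hG.1|].
  exact: logical_mulmx hG.1 hM.1.
(* As [G] is logical, the sets [S i] cover all column indices, so indices of equal columns share
   some [S i]. *)
move=> j1 j2 eqG; have [i iP] := hG.1 j1.
by apply: (constS i); rewrite inE -?eqG iP.
Qed.
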